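(* Let $\mathcal{O}$ be the odd-distance graph, i.e. the graph with vertex set $\mathbb{R}^2$ in which two points are adjacent if and only if their Euclidean distance is an odd integer. Then the measurable chromatic number of $\mathcal{O}$ is infinite; that is, for no positive integer $n$ does there exist a partition of $\mathbb{R}^2$ into $n$ Lebesgue measurable sets $I_1,\dots,I_n$ such that no $I_j$ contains two points at odd integer distance from each other.
   Context: The measurable chromatic number of a graph with vertex set $\mathbb{R}^2$ is the least number of colors needed to properly color the vertices (adjacent vertices receive different colors) so that each color class is a Lebesgue measurable set; it is infinite if no such coloring with finitely many colors exists. *)

(* Defs.v *)
From HB Require Import structures.
From mathcomp Require Import all_boot all_order all_algebra.
From mathcomp Require Import all_classical all_reals all_analysis.
From mathcomp Require Import measurable_realfun.

Set Implicit Arguments.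
Unset Strict Implicit.
Unset Printing Implicit Defensive.

Import Order.TTheory GRing.Theory Num.Theory.
Local Open Scope classical_set_scope.
Local Open Scope ring_scope.

Record graph (V : Type) := Graph {
  adj : V -> V -> Prop;
  adj_sym : forall x y, adj x y -> adj y x;
  adj_irrefl : forall x, ~ adj x x }.

(* The norm carried by the product R * R in the library is the sup norm, so the
   Euclidean distance is written out. *)
Definition euclid_dist (R : realType) (x y : R * R) : R :=
  Num.sqrt ((x.1 - y.1) ^+ 2 + (x.2 - y.2) ^+ 2).

Definition odd_distance (R : realType) (x y : R * R) : Prop :=
  exists k : int, euclid_dist x y = (2 * k + 1)%:~R.

Lemma odd_distance_sym (R : realType) (x y : R * R) :
  odd_distance x y -> odd_distance y x.
Proof.
move=> [k dk]; exists k; rewrite -dk /euclid_dist.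
by rewrite -(sqrrN (y.1 - x.1)) opprB -(sqrrN (y.2 - x.2)) opprB.
Qed.

Lemma odd_distance_irrefl (R : realType) (x : R * R) : ~ odd_distance x x.
Proof.
move=> [k]; rewrite /euclid_dist !subrr expr0n /= addr0 sqrtr0.
move/esym/eqP; rewrite intr_eq0 addr_eq0 => /eqP /(congr1 absz).
by rewrite abszM => /(congr1 odd); rewrite oddM.
Qed.

Definition odd_distance_graph (R : realType) : graph (R * R) :=
  Graph (@odd_distance_sym R) (@odd_distance_irrefl R).

(* [measurable] on R * R denotes the Borel sets; the Lebesgue measurable sets
   are their completion, the sets A `|` N with A Borel and N contained in a
   Borel set of planar Lebesgue measure 0. *)
Definition lebesgue_measurable (R : realType) (A : set (R * R)) : Prop :=
  completed_algebra_gen (@lebesgue_measure R \x @lebesgue_measure R)%E A.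

Definition measurably_colorable (R : realType) (G : graph (R * R)) (n : nat) :
    Prop :=
  exists c : R * R -> 'I_n,
    (forall x y, adj G x y -> c x <> c y) /\
    (forall i, lebesgue_measurable (c @^-1` [set i])).

(* An infimum of natural numbers is attained when there is one, and the infimum
   of the empty set is +oo. *)
Definition measurable_chromatic_number (R : realType) (G : graph (R * R)) :
    \bar R :=
  ereal_inf [set (n%:R)%:E | n in measurably_colorable G].

(* Main.v *)
Require Import Defs.
From mathcomp Require Import all_boot all_order all_algebra.
From mathcomp Require Import all_classical all_reals all_analysis.
From mathcomp Require Import ring zify.

Import Order.TTheory GRing.Theory Num.Theory.
Local Open Scope classical_set_scope.
Local Open Scope ring_scope.

(* The shift graph, whose vertices are the pairs i < j below N with (i, j) joined
   to (j, k), needs at least log2 N colors, so it suffices to place it in the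
   plane with odd distances.  Let t be the argument of
   alpha = (1 + sqrt (-7)) / 2, and send (i, j) to the intersection of the
   tangents to a circle of radius c at the angles 2it and 2jt.  The images of
   (i, j) and (j, k) lie on the tangent at 2jt, at the signed distances
   - c tan ((j - i) t) and c tan ((k - j) t) from the point of tangency.  With
   alpha^m = (L_m + sqrt (-7) F_m) / 2 one has tan (mt) = sqrt 7 * F_m / L_m,
   where F_m and L_m are odd for m > 0, and the distance of the images is
   2 sqrt 7 c |F_(k - i) / (L_(j - i) L_(k - j))|, an odd integer when
   2 sqrt 7 c is an odd common multiple of all the products L_a L_b. *)

(* The pair (a, b) stands for a + b * alpha, where alpha ^ 2 = alpha - 2. *)
Fixpoint alpha_pow (m : nat) : int * int :=
  if m is m'.+1 then
    (- (2 * (alpha_pow m').2), (alpha_pow m').1 + (alpha_pow m').2)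
  else (1, 0).

(** Since 2 alpha = 1 + sqrt (-7), twice a + b * alpha is (2a + b) + b * sqrt (-7); this gives F_m
    and L_m. *)
Definition lucasF (m : nat) : int := (alpha_pow m).2.
Definition lucasL (m : nat) : int := 2 * (alpha_pow m).1 + (alpha_pow m).2.

Lemma alpha_powD (m n : nat) :
  alpha_pow (m + n) =
  ((alpha_pow m).1 * (alpha_pow n).1 - 2 * (alpha_pow m).2 * (alpha_pow n).2,
   (alpha_pow m).1 * (alpha_pow n).2 + (alpha_pow m).2 * (alpha_pow n).1
     + (alpha_pow m).2 * (alpha_pow n).2).
Proof.
elim: m => [|m IHm].
  by rewrite add0n; case: (alpha_pow n) => a b /=; congr (_, _); ring.
by rewrite addSn /= IHm /=; congr (_, _); ring.
Qed.

Lemma lucasLD (m n : nat) :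
  2 * lucasL (m + n) = lucasL m * lucasL n - 7 * (lucasF m * lucasF n).
Proof. by rewrite /lucasL /lucasF alpha_powD /=; ring. Qed.

Lemma lucasFD (m n : nat) :
  2 * lucasF (m + n) = lucasL m * lucasF n + lucasF m * lucasL n.
Proof. by rewrite /lucasL /lucasF alpha_powD /=; ring. Qed.

(** The norm is multiplicative and alpha has norm 2; both sides are 4 times the norm of alpha^m. *)
Lemma lucas_norm (m : nat) :
  lucasL m ^+ 2 + 7 * lucasF m ^+ 2 = 4 * 2 ^+ m.
Proof.
have norm_alpha : (alpha_pow m).1 ^+ 2 + (alpha_pow m).1 * (alpha_pow m).2
    + 2 * (alpha_pow m).2 ^+ 2 = 2 ^+ m.
  elim: m => [|m IHm] /=; first by rewrite expr1n expr0n !mulr0 !addr0.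
  by rewrite [RHS]exprS -IHm; ring.
by rewrite -norm_alpha /lucasL /lucasF; ring.
Qed.

(** Modulo 2 the recursion is (a, b) -> (0, a + b), so (1, 0) moves to (0, 1) and stays there. *)
Lemma odd_alpha_pow (m : nat) :
  ~~ odd `|(alpha_pow m.+1).1| /\ odd `|(alpha_pow m.+1).2|.
Proof. by elim: m => [|m [evA oddB]] //=; move: evA oddB => /=; lia. Qed.

Lemma odd_lucasF (m : nat) : (0 < m)%N -> odd `|lucasF m|.
Proof. by case: m => // m _; have [_] := odd_alpha_pow m. Qed.

Lemma odd_lucasL (m : nat) : (0 < m)%N -> odd `|lucasL m|.
Proof.
case: m => // m _; have [_] := odd_alpha_pow m; rewrite /lucasL; lia.
Qed.

Definition lucas_prod (n : nat) : int := \prod_(1 <= a < n.+1) lucasL a.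

(** The cofactor is the product of the other factors, all odd. *)
Lemma lucas_prod_factor (n a : nat) : (0 < a <= n)%N ->
  exists2 r : int, lucas_prod n = r * lucasL a & odd `|r|.
Proof.
elim: n => [|n IHn]; first by case: a.
rewrite /lucas_prod big_nat_recr //= -/(lucas_prod n) => /andP[a_gt0].
rewrite leq_eqVlt => /orP[/eqP->|a_le].
  exists (lucas_prod n) => //; rewrite /lucas_prod.
  elim: {a a_gt0 IHn}n => [|n IHn]; first by rewrite big_geq.
  by rewrite big_nat_recr //= abszM oddM IHn odd_lucasL.
have [|r -> odd_r] := IHn; first by rewrite a_gt0.
exists (r * lucasL n.+1); first by ring.
by rewrite abszM oddM odd_r odd_lucasL.
Qed.

Lemma odd_distance_absz (R : realType) (x y : R * R) (z : int) :
  odd `|z| -> euclid_dist x y = `|z%:~R| -> odd_distance x y.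
Proof.
move=> odd_z dist_z; exists (Posz `|z|./2); rewrite dist_z -intr_norm; congr _%:~R.
by have := odd_double_half `|z|; rewrite odd_z; lia.
Qed.

(* In polar coordinates: radius c / cos ((j - i) t), angle (i + j) t. *)
Definition tangent_point {R : realType} (c : R) (i j : nat) : R * R :=
  (c * ((lucasL (i + j))%:~R / (2 ^+ i * (lucasL (j - i))%:~R)),
   c * (Num.sqrt 7 * (lucasF (i + j))%:~R / (2 ^+ i * (lucasL (j - i))%:~R))).

Lemma lucasL_neq0 (R : realType) (m : nat) :
  (0 < m)%N -> (lucasL m)%:~R != 0 :> R.
Proof.
by move/odd_lucasL; rewrite intr_eq0; apply: contraTneq => ->.
Qed.

(* Here q = 2^i, p = 2^(j - i), the indices m, a, b stand for i + j, j - i, k - j,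
   and L, F, L', F', Fab have the indices m + a, m + a + b and a + b. *)
Lemma sqr_dist_tangent_point (K : fieldType)
    (c s q p Lm Fm La Fa Lb Fb L F L' F' Fab : K) :
  2 != 0 :> K -> La != 0 -> Lb != 0 -> q != 0 -> p != 0 -> s ^+ 2 = 7 ->
  2 * L = Lm * La - 7 * (Fm * Fa) -> 2 * F = Lm * Fa + Fm * La ->
  2 * L' = L * Lb - 7 * (F * Fb) -> 2 * F' = L * Fb + F * Lb ->
  2 * Fab = La * Fb + Fa * Lb ->
  La ^+ 2 + 7 * Fa ^+ 2 = 4 * p -> L ^+ 2 + 7 * F ^+ 2 = 4 * (q * p) ^+ 2 ->
  (c * (Lm / (q * La)) - c * (L' / (q * p * Lb))) ^+ 2 +
  (c * (s * Fm / (q * La)) - c * (s * F' / (q * p * Lb))) ^+ 2 =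
  (c * (2 * s) * Fab / (La * Lb)) ^+ 2.
Proof.
move=> n2 La0 Lb0 q0 p0 s7 defL defF defL' defF' defFab normA normJ.
have p4 : 4 * p != 0 by rewrite mulf_neq0 // -[4]/((2 * 2)%:R) natrM mulf_neq0.
have half (x y : K) : 2 * x = y -> x = y / 2 by move=> <-; field.
(* Multiplying alpha^(m + a) by the conjugate of alpha^a gives p * alpha^m. This puts both points in
   terms of the common tangent, whose index is m + a. *)
have eLm : Lm = (L * La + 7 * F * Fa) / (2 * p).
  apply: (mulfI p4); rewrite -{1}normA (half _ _ defL) (half _ _ defF).
  by field; rewrite n2 p0.
have eFm : Fm = (F * La - L * Fa) / (2 * p).
  apply: (mulfI p4); rewrite -{1}normA (half _ _ defL) (half _ _ defF).
  by field; rewrite n2 p0.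
rewrite eLm eFm (half _ _ defL') (half _ _ defF') (half _ _ defFab).
transitivity (c ^+ 2 * (La * Fb + Fa * Lb) ^+ 2 *
    (49 * F ^+ 2 + s ^+ 2 * L ^+ 2) / (2 * q * p * La * Lb) ^+ 2).
  by field; rewrite n2 La0 Lb0 q0 p0.
transitivity (c ^+ 2 * (La * Fb + Fa * Lb) ^+ 2 *
    (s ^+ 2 * (4 * (q * p) ^+ 2)) / (2 * q * p * La * Lb) ^+ 2).
  by rewrite -normJ s7; congr (_ * _ / _); ring.
by field; rewrite n2 La0 Lb0 q0 p0.
Qed.

Lemma dist_tangent_point {R : realType} (c : R) (i j k : nat) :
  (i < j)%N -> (j < k)%N ->
  euclid_dist (tangent_point c i j) (tangent_point c j k) =
  `|c * (2 * Num.sqrt 7) * (lucasF (k - i))%:~R /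
    ((lucasL (j - i))%:~R * (lucasL (k - j))%:~R)|.
Proof.
move=> ij jk; rewrite /euclid_dist -sqrtr_sqr; congr Num.sqrt => /=.
pose a := (j - i)%N; pose b := (k - j)%N; pose m := (i + j)%N.
have -> : (j + k)%N = (m + a + b)%N by rewrite /m /a /b; lia.
have -> : (k - i)%N = (a + b)%N by rewrite /a /b; lia.
have -> : 2 ^+ j = 2 ^+ i * 2 ^+ a :> R by rewrite -exprD; congr (_ ^+ _); lia.
rewrite -/a -/b -/m.
have castD (z x y u v : int) : 2 * z = x * y + u * v ->
    2 * z%:~R = x%:~R * y%:~R + u%:~R * v%:~R :> R.
  by move/(congr1 (intr : int -> R)); rewrite intrD !intrM.
have castB (z x y u v : int) : 2 * z = x * y - 7 * (u * v) ->
    2 * z%:~R = x%:~R * y%:~R - 7 * (u%:~R * v%:~R) :> R.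
  by move/(congr1 (intr : int -> R)); rewrite intrB !intrM.
have cast_norm (x y : int) (n : nat) : x ^+ 2 + 7 * y ^+ 2 = 4 * 2 ^+ n ->
    x%:~R ^+ 2 + 7 * y%:~R ^+ 2 = 4 * 2 ^+ n :> R.
  by move/(congr1 (intr : int -> R)); rewrite intrD !intrM !rmorphXn.
apply: (@sqr_dist_tangent_point _ _ _ _ _ _ _ _ (lucasF a)%:~R _ (lucasF b)%:~R
  (lucasL (m + a))%:~R (lucasF (m + a))%:~R).
- by rewrite pnatr_eq0.
- by apply: lucasL_neq0; rewrite /a; lia.
- by apply: lucasL_neq0; rewrite /b; lia.
- by rewrite expf_neq0 // pnatr_eq0.
- by rewrite expf_neq0 // pnatr_eq0.
- by rewrite sqr_sqrtr.
- exact/castB/lucasLD.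
- exact/castD/lucasFD.
- exact/castB/lucasLD.
- exact/castD/lucasFD.
- exact/castD/lucasFD.
- exact/cast_norm/lucas_norm.
(* Here m + a = 2j, so the norm of alpha^(m + a) is the square of 2^j. *)
- rewrite -exprD -exprM; apply/cast_norm.
  by rewrite lucas_norm; congr (_ * _ ^+ _); rewrite /m /a; lia.
Qed.

Lemma odd_distance_tangent_point {R : realType} (n i j k : nat) :
  (i < j)%N -> (j < k)%N -> (k <= n)%N ->
  (* The square is there because j - i and k - j may coincide. *)
  let c := (lucas_prod n ^+ 2)%:~R / (2 * Num.sqrt 7) : R in
  odd_distance (tangent_point c i j) (tangent_point c j k).
Proof.
move=> ij jk kn c.
have [|r defr odd_r] := @lucas_prod_factor n (j - i); first by lia.
have [|t deft odd_t] := @lucas_prod_factor n (k - j); first by lia.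
(* Each copy of [lucas_prod n] cancels one denominator and leaves its odd cofactor, [r] or [t]. *)
apply: (@odd_distance_absz _ _ _ (r * t * lucasF (k - i))).
  by rewrite !abszM !oddM odd_r odd_t odd_lucasF //; lia.
rewrite dist_tangent_point //; congr `|_|.
have L1 : (lucasL (j - i))%:~R != 0 :> R by apply: lucasL_neq0; lia.
have L2 : (lucasL (k - j))%:~R != 0 :> R by apply: lucasL_neq0; lia.
have s7 : Num.sqrt 7 != 0 :> R by rewrite sqrtr_eq0 -ltNge.
rewrite /c expr2 {1}defr deft !intrM.
by field; rewrite L1 L2 s7.
Qed.

Lemma shift_graph_coloring (n k : nat) (c : nat -> nat -> 'I_k) :
  (2 ^ k < n)%N ->
  exists i j l : nat, [/\ (i < j)%N, (j < l)%N, (l < n)%N & c i j = c j l].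
Proof.
move=> kn; apply: contrapT => proper.
(* For i < j the color c i j is in C i but not in C j, so that C is injective. *)
pose C (i : 'I_n) : {set 'I_k} :=
  [set col | [exists j : 'I_n, (i < j)%N && (c i j == col)]]%SET.
have neqC (i j : 'I_n) : (i < j)%N -> C i != C j.
  move=> ij; apply/eqP => /setP/(_ (c i j)); rewrite !inE.
  have -> : [exists l : 'I_n, (i < l)%N && (c i l == c i j)].
    by apply/existsP; exists j; rewrite ij eqxx.
  move/esym/existsP => [l /andP[jl /eqP eqc]].
  by apply: proper; exists i, j, l; split.
have injC : injective C.
  move=> i j eqC; apply/val_inj; case: (ltngtP i j) => // lt.
    by have := neqC _ _ lt; rewrite eqC eqxx.
  by have := neqC _ _ lt; rewrite eqC eqxx.
have := max_card (mem (codom C)); rewrite (card_codom injC) card_ord.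
by rewrite -cardsT -powersetT card_powerset cardsT card_ord leqNgt kn.
Qed.

Lemma monochromatic_odd_distance {R : realType} (n : nat) (c : R * R -> 'I_n) :
  exists x y, odd_distance x y /\ c x = c y.
Proof.
pose r : R := (lucas_prod (2 ^ n) ^+ 2)%:~R / (2 * Num.sqrt 7).
(* The indices run from 0 to 2^n inclusive, hence the bound 2^n in [r]. *)
have [i [j [l [ij jl ln eqc]]]] :=
  @shift_graph_coloring (2 ^ n).+1 n (fun i j => c (tangent_point r i j)) (ltnSn _).
exists (tangent_point r i j), (tangent_point r j l); split => //.
exact: odd_distance_tangent_point.
Qed.

Theorem mainTheorem1 (R : realType) :
  measurable_chromatic_number (odd_distance_graph R) = +oo%E /\
  (forall n : nat, (0 < n)%N ->
    ~ exists I : 'I_n -> set (R * R),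
        [/\ \bigcup_(j in [set: 'I_n]) I j = [set: R * R],
            trivIset [set: 'I_n] I,
            forall j, lebesgue_measurable (I j) &
            forall j x y, I j x -> I j y -> ~ odd_distance x y]).
Proof.
split.
  rewrite /measurable_chromatic_number.
  suff -> : measurably_colorable (odd_distance_graph R) = set0.
    by rewrite image_set0 ereal_inf0.
  rewrite -subset0 => n [c [proper _]].
  have [x [y [xy eqc]]] := monochromatic_odd_distance n c.
  exact: proper xy eqc.
move=> n _ [I [cover _ _ avoid]].
have colorP (x : R * R) : exists j, I j x.
  by have : [set: R * R] x by []; rewrite -cover => -[j _ Ijx]; exists j.
have [c Ic] := choice colorP.
have [x [y [xy eqc]]] := monochromatic_odd_distance n c.
by apply: avoid xy; [exact: Ic | rewrite eqc; exact: Ic].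
Qed.
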